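(* Let $t>0$. Over the duration $t$, the IndivRed mechanism allows a (constant) relative power reduction of $$R_{\mathrm{IndivRed}} = \left[1-t\,\frac{v+w}{\Delta}\right]^+ ,$$ i.e. when IndivRed is applied for a reduction request of duration $t$ issued at time $0$, the aggregated consumption at (almost) every time in $[0,t]$ equals $(1-R_{\mathrm{IndivRed}})\,P_{\mathrm{tot}}$.
   Context: Notation: $[x]^+:=\max(0,x)$. Let $\Delta,v,w,P,N>0$ be constants. There is a large number $N$ of identical appliances, treated as a continuum. Each appliance has to keep a temperature within an interval $[T_{\min},T_{\max}]$ of length $\Delta=T_{\max}-T_{\min}$ by means of a temperature modifier that is either ON (consuming power $P$) or OFF (consuming no power). Call ''drift limit'' the end of the interval towards which the temperature drifts when the modifier is OFF ($T_{\max}$ for a cooling appliance, $T_{\min}$ for a heating appliance), and let $\delta\in[0,\Delta]$ be the distance between the current temperature and the drift limit. When the modifier is ON, $\delta$ increases at constant speed $v$; when it is OFF, $\delta$ decreases at constant speed $w$. Nominal behavior (no request): the modifier is switched ON when $\delta$ reaches $0$, stays ON until $\delta=\Delta$ (duration $\Delta/v$), then is OFF until $\delta=0$ (duration $\Delta/w$), and so on periodically; the cycle length is $L:=\Delta/v+\Delta/w$. The position of an appliance is the time $y\in[0,L]$ elapsed, at time $0$, since the beginning of its current cycle (the last nominal switching to ON). Thus at time $0$ the distance of an appliance of position $y$ to the drift limit is $vy$ if $0\le y\le\Delta/v$ and $\Delta-w(y-\Delta/v)$ if $\Delta/v\le y\le L$. Standing assumption: when the request is issued (time $0$), the positions $y$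 of the appliances are uniformly distributed over $[0,L]$; hence if the appliance of position $y$ is in state $u_y(\tau)\in\{0,1\}$ (1 for ON) at time $\tau$, the aggregated consumption at time $\tau$ is $\frac{NP}{L}\int_0^L u_y(\tau)\,dy$. Without any request it is constant and equal to $P_{\mathrm{tot}}=NP\frac{w}{v+w}$. Individual reduction duration: if an appliance of position $y$ switches OFF at time $0$, it offers a consumption reduction (being OFF while it would have been ON without the request) until either its temperature reaches the drift limit or the time at which it would nominally have switched OFF; this lasts for a duration $t_{\mathrm{red}}(y)=\min\left(\frac{yv}{w},\left[\frac{\Delta}{v}-y\right]^+\right)$ (in particular $0$ if the appliance is already OFF). IndivRed mechanism for duration $t$: at time $0$, every appliance with $t_{\mathrm{red}}(y)\ge t$ switches OFF and stays OFF as long as it can, i.e. until its temperature reaches the drift limit, after which it resumes the usual functioning (ON until $\delta=\Delta$, then OFF until $\delta=0$, etc.); all other appliances keep their nominal behavior. *)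

(* Defs.v *)
(* Stdlib reals, with Coquelicot's Riemann integral. *)
From Stdlib Require Import Reals.
From Coquelicot Require Import Coquelicot.
Open Scope R_scope.

Definition pos_part (x : R) : R := Rmax 0 x.

Definition cycle_length (Delta v w : R) : R := Delta / v + Delta / w.

(* State (true = ON) of a modifier following the usual functioning, [s] time
   units after the beginning of one of its cycles: [s] is reduced modulo the
   cycle length, and the ON phase is the first [Delta / v] units of the cycle.
   The ON phase is taken closed on the left and open on the right. *)
Definition usual_state (Delta v w s : R) : bool :=
  let L := cycle_length Delta v w in
  if Rlt_dec (L * frac_part (s / L)) (Delta / v) then true else false.

Definition nominal_state (Delta v w y tau : R) : bool :=
  usual_state Delta v w (y + tau).

(* Distance to the drift limit at time 0 of the appliance of position
   [y] in [0, L]. *)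
Definition initial_distance (Delta v w y : R) : R :=
  if Rle_dec y (Delta / v) then v * y else Delta - w * (y - Delta / v).

(* Time at which an appliance that is OFF from time 0 on reaches its drift
   limit: the distance decreases at speed [w]. *)
Definition drift_time (Delta v w y : R) : R := initial_distance Delta v w y / w.

Definition t_red (Delta v w y : R) : R :=
  Rmin (y * v / w) (pos_part (Delta / v - y)).

(* An appliance that takes part begins a new usual cycle when it reaches the
   drift limit. *)
Definition IndivRed_state (Delta v w t y tau : R) : bool :=
  if Rle_dec t (t_red Delta v w y) then
    let d := drift_time Delta v w y in
    if Rlt_dec tau d then false else usual_state Delta v w (tau - d)
  else nominal_state Delta v w y tau.

Definition indicator (b : bool) : R := if b then 1 else 0.

(* [u y tau] is the state at time [tau] of the appliance of position [y];
   positions are uniformly distributed over a cycle. *)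
Definition consumption (Delta v w P N : R) (u : R -> R -> bool) (tau : R) : R :=
  let L := cycle_length Delta v w in
  N * P / L * RInt (fun y => indicator (u y tau)) 0 L.

Definition P_tot (v w P N : R) : R := N * P * (w / (v + w)).

Definition R_IndivRed (Delta v w t : R) : R :=
  pos_part (1 - t * ((v + w) / Delta)).

(* Main.v *)
Require Import Defs.
From Stdlib Require Import Reals Lra.
From Coquelicot Require Import Coquelicot.
Open Scope R_scope.

(** Write [L] for the cycle length.

    Without a request, exactly a fraction [(Delta / v) / L = w / (v + w)] of the
    positions is ON at any time [tau], because [y + tau] sweeps one full period
    of the usual functioning as [y] runs from [0] to [L]
    ([is_RInt_nominal_state]).

    Since [t > 0], the condition [t <= t_red y] selects the positions
    [t * w / v <= y <= Delta / v - t].  Up to time [t], and apart from the ends of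
    that interval, an appliance in it would nominally be ON, but is OFF under
    IndivRed because its drift time [y * v / w] is at least [t].  So the
    mechanism removes from the integral of the states exactly the length of
    that interval, [Delta / v - t - t * w / v], which is the fraction
    [1 - t * (v + w) / Delta] of the nominal integral [Delta / v]
    ([is_RInt_replace]).  When the length is negative nobody takes part and the
    consumption is nominal, whence the positive part in [R_IndivRed]. *)

(** * Integrals of piecewise constant functions *)

Lemma is_RInt_constant_on (f : R -> R) (a b c : R) :
  a <= b -> (forall x, a < x < b -> f x = c) -> is_RInt f a b (c * (b - a)).
Proof.
intros Hab Hf.
replace (c * (b - a)) with (scal (b - a) c)
  by (unfold scal; simpl; unfold mult; simpl; ring).
apply is_RInt_ext with (fun _ => c).
- intros x. rewrite Rmin_left, Rmax_right by lra. intros Hx. now rewrite Hf.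
- apply (is_RInt_const a b c).
Qed.

Lemma is_RInt_three_pieces (f : R -> R) (a b c d ia ib ic l : R) :
  is_RInt f a b ia -> is_RInt f b c ib -> is_RInt f c d ic ->
  ia + ib + ic = l -> is_RInt f a d l.
Proof.
intros H1 H2 H3 <-.
apply (is_RInt_Chasles f a c d (ia + ib) ic); [|exact H3].
exact (is_RInt_Chasles f a b c ia ib H1 H2).
Qed.

(** The two functions may disagree with the prescribed constants at [p] and [q]:
    this absorbs the appliances that sit exactly at a switching time. *)
Lemma is_RInt_replace (f g : R -> R) (a p q b c c' l : R) :
  a <= p -> p <= q -> q <= b ->
  is_RInt f a b l ->
  (forall x, p < x < q -> f x = c) ->
  (forall x, p < x < q -> g x = c') ->
  (forall x, x < p \/ q < x -> g x = f x) ->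
  is_RInt g a b (l - (c - c') * (q - p)).
Proof.
intros Hap Hpq Hqb Hf Hc Hc' Hout.
assert (Hex : ex_RInt f a b) by now exists l.
assert (Hexq : ex_RInt f a q) by (apply (ex_RInt_Chasles_1 (V := R_CompleteNormedModule) f a q b); [lra|exact Hex]).
destruct (ex_RInt_Chasles_2 (V := R_CompleteNormedModule) f a q b (conj (Rle_trans _ _ _ Hap Hpq) Hqb) Hex)
  as [l3 H3].
destruct (ex_RInt_Chasles_1 (V := R_CompleteNormedModule) f a p q (conj Hap Hpq) Hexq) as [l1 H1].
pose proof (is_RInt_constant_on f p q c Hpq Hc) as H2.
pose proof (is_RInt_three_pieces f a p q b _ _ _ _ H1 H2 H3 eq_refl) as H.
assert (Hl : l = l1 + c * (q - p) + l3)
  by (rewrite <- (is_RInt_unique _ _ _ _ Hf); exact (is_RInt_unique _ _ _ _ H)).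
apply is_RInt_three_pieces with p q l1 (c' * (q - p)) l3.
- apply is_RInt_ext with f; [|exact H1].
  intros x. rewrite Rmax_right by lra. intros Hx. rewrite Hout; [reflexivity|lra].
- now apply is_RInt_constant_on.
- apply is_RInt_ext with f; [|exact H3].
  intros x. rewrite Rmin_left by lra. intros Hx. rewrite Hout; [reflexivity|lra].
- rewrite Hl. ring.
Qed.

(** * The usual functioning *)

(** Reduction modulo [L], with the quotient [k] known. *)
Lemma scaled_frac_part (L s : R) (k : Z) :
  0 < L -> IZR k * L <= s < (IZR k + 1) * L ->
  L * frac_part (s / L) = s - IZR k * L.
Proof.
intros HL Hs.
assert (Hk : k = Int_part (s / L)).
{ apply Int_part_spec. split.
  - enough (s / L < IZR k + 1) by lra. apply Rlt_div_l; lra.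
  - apply Rle_div_r; lra. }
unfold frac_part. rewrite <- Hk. field. lra.
Qed.

Section Cycle.

Variables Delta v w : R.
Hypotheses (hDelta : 0 < Delta) (hv : 0 < v) (hw : 0 < w).

Let L := cycle_length Delta v w.
Let ON := Delta / v.

Lemma ON_duration_bounds : 0 < ON < L.
Proof.
unfold L, ON, cycle_length.
pose proof (Rdiv_lt_0_compat _ _ hDelta hv).
pose proof (Rdiv_lt_0_compat _ _ hDelta hw). lra.
Qed.

Lemma usual_state_ON (s : R) (k : Z) :
  IZR k * L <= s < IZR k * L + ON -> usual_state Delta v w s = true.
Proof.
intros Hs. pose proof ON_duration_bounds.
unfold usual_state. fold L ON.
rewrite (scaled_frac_part L s k) by lra.
destruct Rlt_dec; [reflexivity|lra].
Qed.

Lemma usual_state_OFF (s : R) (k : Z) :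
  IZR k * L + ON <= s < (IZR k + 1) * L -> usual_state Delta v w s = false.
Proof.
intros Hs. pose proof ON_duration_bounds.
unfold usual_state. fold L ON.
rewrite (scaled_frac_part L s k) by lra.
destruct Rlt_dec; [lra|reflexivity].
Qed.

(** With [tau = k * L + r] and [0 <= r < L], the window from [tau] to [tau + L] meets
    the cycles [k] and [k + 1].  It starts inside an ON phase, which it then
    completes at its end (pattern ON, OFF, ON), or inside an OFF phase (pattern
    OFF, ON, OFF). *)
Lemma is_RInt_nominal_state (tau : R) :
  is_RInt (fun y => indicator (nominal_state Delta v w y tau)) 0 L ON.
Proof.
pose proof ON_duration_bounds as HL.
set (k := Int_part (tau / L)). set (r := tau - IZR k * L).
assert (Hr : 0 <= r < L).
{ destruct (base_fp (tau / L)) as [H0 H1].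
  assert (Hrf : r = L * frac_part (tau / L))
    by (unfold r, frac_part; fold k; field; lra).
  rewrite Hrf. split.
  - apply Rmult_le_pos; lra.
  - apply Rlt_le_trans with (L * 1); [apply Rmult_lt_compat_l; lra|lra]. }
assert (Hk1 : IZR (k + 1) = IZR k + 1) by apply plus_IZR.
unfold nominal_state.
destruct (Rlt_dec r ON) as [Hin|Hin].
- apply is_RInt_three_pieces
    with (ON - r) (L - r) (1 * (ON - r - 0)) (0 * (L - r - (ON - r)))
         (1 * (L - (L - r))); [| | |ring];
    apply is_RInt_constant_on; try lra; intros y Hy.
  + rewrite (usual_state_ON _ k); [reflexivity|unfold r in *; lra].
  + rewrite (usual_state_OFF _ k); [reflexivity|unfold r in *; lra].
  + rewrite (usual_state_ON _ (k + 1)); [reflexivity|rewrite Hk1; unfold r in *; lra].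
- apply is_RInt_three_pieces
    with (L - r) (L - r + ON) (0 * (L - r - 0)) (1 * (L - r + ON - (L - r)))
         (0 * (L - (L - r + ON))); [| | |ring];
    apply is_RInt_constant_on; try lra; intros y Hy.
  + rewrite (usual_state_OFF _ k); [reflexivity|unfold r in *; lra].
  + rewrite (usual_state_ON _ (k + 1)); [reflexivity|rewrite Hk1; unfold r in *; lra].
  + rewrite (usual_state_OFF _ (k + 1)); [reflexivity|rewrite Hk1; unfold r in *; lra].
Qed.

(** * The participating appliances *)

(** For [t > 0] the positive part in [t_red] never makes an appliance
    participate: a position beyond the ON phase has [t_red] equal to 0. *)
Lemma participation_interval (t y : R) :
  0 < t -> t <= t_red Delta v w y <-> t * w / v <= y <= ON - t.
Proof.
intros ht. unfold t_red, pos_part. fold ON.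
assert (Hdrift : t <= y * v / w <-> t * w / v <= y).
{ rewrite <- Rle_div_r, Rle_div_l by lra. reflexivity. }
rewrite <- Hdrift. split.
- intros H. split.
  + eapply Rle_trans; [exact H|apply Rmin_l].
  + assert (H2 : t <= Rmax 0 (ON - y)) by (eapply Rle_trans; [exact H|apply Rmin_r]).
    unfold Rmax in H2. destruct Rle_dec in H2; lra.
- intros [H1 H2]. apply Rmin_glb; [exact H1|].
  eapply Rle_trans; [|apply Rmax_r]. lra.
Qed.

Lemma IndivRed_state_outside (t tau y : R) :
  0 < t -> y < t * w / v \/ ON - t < y ->
  IndivRed_state Delta v w t y tau = nominal_state Delta v w y tau.
Proof.
intros ht Hy. unfold IndivRed_state.
destruct (Rle_dec t (t_red Delta v w y)) as [H|H]; [|reflexivity].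
apply participation_interval in H; lra.
Qed.

Lemma IndivRed_state_inside (t tau y : R) :
  0 <= tau <= t -> 0 < t -> t * w / v < y < ON - t ->
  IndivRed_state Delta v w t y tau = false.
Proof.
intros Htau ht Hy. unfold IndivRed_state.
destruct (Rle_dec t (t_red Delta v w y)) as [_|H].
2: { exfalso. apply H, participation_interval; lra. }
assert (Hd : t < drift_time Delta v w y).
{ unfold drift_time, initial_distance. fold ON.
  destruct (Rle_dec y ON); [|lra].
  apply Rlt_div_r; [lra|].
  rewrite (Rmult_comm v). apply Rlt_div_l; lra. }
destruct Rlt_dec; [reflexivity|lra].
Qed.

Lemma nominal_state_inside (t tau y : R) :
  0 <= tau <= t -> 0 < t -> t * w / v < y < ON - t ->
  nominal_state Delta v w y tau = true.
Proof.
intros Htau ht Hy. unfold nominal_state.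
assert (0 < t * w / v) by (apply Rdiv_lt_0_compat; [nra|lra]).
apply (usual_state_ON _ 0); lra.
Qed.

Lemma is_RInt_IndivRed_state (t tau : R) :
  0 < t -> 0 <= tau <= t ->
  is_RInt (fun y => indicator (IndivRed_state Delta v w t y tau)) 0 L
    (ON * (1 - R_IndivRed Delta v w t)).
Proof.
intros ht Htau. pose proof ON_duration_bounds as HL.
assert (Hp : 0 < t * w / v) by (apply Rdiv_lt_0_compat; [nra|lra]).
(* The signed length of the participation interval, relative to the ON phase. *)
assert (Hlen : ON * (1 - t * ((v + w) / Delta)) = ON - t - t * w / v)
  by (unfold ON; field; lra).
unfold R_IndivRed, pos_part.
destruct (Rle_dec (t * w / v) (ON - t)) as [Hne|Hempty].
- rewrite Rmax_right by (apply Rmult_le_reg_l with ON; lra).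
  replace (ON * (1 - (1 - t * ((v + w) / Delta))))
    with (ON - (1 - 0) * (ON - t - t * w / v)) by lra.
  apply is_RInt_replace
    with (f := fun y => indicator (nominal_state Delta v w y tau)); try lra.
  + apply is_RInt_nominal_state.
  + intros y Hy. now rewrite (nominal_state_inside t).
  + intros y Hy. now rewrite IndivRed_state_inside.
  + intros y Hy. now rewrite IndivRed_state_outside.
- rewrite Rmax_left by (apply Rmult_le_reg_l with ON; lra).
  rewrite Rminus_0_r, Rmult_1_r.
  apply is_RInt_ext with (fun y => indicator (nominal_state Delta v w y tau)).
  + intros y _. rewrite IndivRed_state_outside; [reflexivity|lra|lra].
  + apply is_RInt_nominal_state.
Qed.

End Cycle.

(** * The relative power reduction *)

Theorem proposition2 (Delta v w P N t : R)
  (hDelta : 0 < Delta) (hv : 0 < v) (hw : 0 < w) (hP : 0 < P) (hN : 0 < N)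
  (ht : 0 < t) :
  forall tau : R, 0 <= tau <= t ->
    ex_RInt (fun y => indicator (IndivRed_state Delta v w t y tau))
      0 (cycle_length Delta v w) /\
    consumption Delta v w P N (IndivRed_state Delta v w t) tau
      = (1 - R_IndivRed Delta v w t) * P_tot v w P N.
Proof.
intros tau Htau.
pose proof (is_RInt_IndivRed_state Delta v w hDelta hv hw t tau ht Htau) as H.
split; [eexists; exact H|].
unfold consumption. rewrite (is_RInt_unique _ _ _ _ H).
unfold P_tot, cycle_length. field. repeat split; nra.
Qed.
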